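(* Let $(A,M,T)$ be a relative Rota-Baxter algebra over a field of characteristic $0$. Then there is a long exact sequence of cohomology spaces $$\cdots\to H^n(T)\xrightarrow{H^n(i)}H^n(A,M,T)\xrightarrow{H^n(p)}H^n(A,M)\xrightarrow{\delta^n}H^{n+1}(T)\to\cdots,$$ where $i(P)=(0,P)$, $p(f,P)=f$, and the connecting homomorphism is given by $\delta^n([f])=[\Omega f]$ for $[f]\in H^n(A,M)$.
   Context: A relative Rota-Baxter algebra $(A,M,T)$: an associative algebra $A$ with product $\mu$, an $A$-bimodule $M$ with left/right actions $l,r$, and a linear map $T:M\to A$ with $T(m)T(n)=T(T(m)n+mT(n))$. Put $\pi=\mu+l+r$, a bilinear map on $A\oplus M$ (maps defined on tensor products of copies of $A$ and $M$ are extended by zero). Gerstenhaber bracket on $\bigoplus_{n\ge0}\mathrm{Hom}(V^{\otimes n+1},V)$, $V=A\oplus M$: for $f\in\mathrm{Hom}(V^{\otimes m+1},V)$, $g\in\mathrm{Hom}(V^{\otimes n+1},V)$, $(f\diamond g)(v_1,\ldots,v_{m+n+1})=\sum_{i=1}^{m+1}(-1)^{(i-1)n}f(v_1,\ldots,v_{i-1},g(v_i,\ldots,v_{i+n}),\ldots,v_{m+n+1})$, $[f,g]=f\diamond g-(-1)^{mn}g\diamond f$. Complexes: (1) $C^0(T)=C^1(T)=0$, $C^n(T)=\mathrm{Hom}(M^{\otimes n-1},A)$ for $n\ge2$, with differential $d_TP=[[\pi,T],P]$; cohomology $H^\bullet(T)$. (2) $\mathcal C^0(A,M)=0$, $\mathcal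 C^n(A,M)=\mathrm{Hom}(A^{\otimes n},A)\oplus\mathrm{Hom}(\mathcal A^{n-1,1},M)$ for $n\ge1$, where $\mathcal A^{n-1,1}$ is the direct sum of all tensor products of $n-1$ copies of $A$ and one copy of $M$ in any order, with differential $\partial f=(-1)^{n-1}[\pi,f]$; cohomology $H^\bullet(A,M)$. (3) $C^0(A,M,T)=0$, $C^1(A,M,T)=\mathrm{Hom}(A,A)\oplus\mathrm{Hom}(M,M)$, $C^n(A,M,T)=\mathcal C^n(A,M)\oplus C^n(T)$ for $n\ge2$, with differential $\mathcal D(f,P)=(\partial f,(-1)^nd_TP+\Omega f)$, where $\Omega:\mathcal C^n(A,M)\to C^{n+1}(T)$ is $$(\Omega f)(u_1,\ldots,u_n)=(-1)^n\Big(f(Tu_1,\ldots,Tu_n)-\sum_{i=1}^nT\,f(Tu_1,\ldots,Tu_{i-1},u_i,Tu_{i+1},\ldots,Tu_n)\Big),\quad u_j\in M;$$ for $n=1$ the component $P$ is absent. Cohomology $H^\bullet(A,M,T)$. *)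

(* Defs.v *)
From HB Require Import structures.
From mathcomp Require Import all_boot all_order all_algebra.
From mathcomp Require Import boolp functions zify.
Set Implicit Arguments.
Unset Strict Implicit.
Unset Printing Implicit Defensive.
Import GRing.Theory.
Local Open Scope ring_scope.
Local Open Scope quotient_scope.

(* Quotient of a vector space by a subspace; [Quotient.quot] only carries  *)
(* a [zmodType] structure in the library.                                     *)
Section QuotientSpace.
Variables (K : fieldType) (V : lmodType K) (S : submodClosed V).

(* [submodClosed] does not inherit from [zmodClosed]. *)
Definition quot_pred : {pred V} := fun v => v \in S.
Fact quot_pred_submod : subsemimod_closed quot_pred.
Proof.
split; first split; first exact: (rpred0 S).
- by move=> u v; exact: (@rpredD _ S).
- by move=> a v; exact: (@rpredZ _ _ S).
Qed.
HB.instance Definition _ :=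
  GRing.isSubmodClosed.Build K V quot_pred quot_pred_submod.

Local Notation Q := (Quotient.quot quot_pred).

Definition quot_space : Type := Q.
HB.instance Definition _ := GRing.Zmodule.on quot_space.

Definition quot_proj (v : V) : quot_space := \pi_Q v.

Lemma quot_projP u v : (quot_proj u == quot_proj v) = (u - v \in S).
Proof. by rewrite /quot_proj -Quotient.idealrBE. Qed.

Lemma quot_proj_repr (q : quot_space) : quot_proj (repr (q : Q)) = q.
Proof. exact: reprK. Qed.

Fact quot_proj_zmod : zmod_morphism quot_proj.
Proof. by move=> u v; rewrite /quot_proj; exact: raddfB. Qed.
HB.instance Definition _ :=
  GRing.isZmodMorphism.Build V quot_space quot_proj quot_proj_zmod.

Definition quot_scale (a : K) (q : quot_space) : quot_space :=
  quot_proj (a *: repr (q : Q)).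

Lemma quot_scaleE a v : quot_scale a (quot_proj v) = quot_proj (a *: v).
Proof.
apply/eqP; rewrite quot_projP -scalerBr.
by apply: (@rpredZ _ _ S); rewrite -quot_projP quot_proj_repr.
Qed.

Fact quot_scaleA a b q : quot_scale a (quot_scale b q) = quot_scale (a * b) q.
Proof. by rewrite -[q]quot_proj_repr !quot_scaleE scalerA. Qed.
Fact quot_scale1 : left_id 1 quot_scale.
Proof. by move=> q; rewrite -[q]quot_proj_repr !quot_scaleE scale1r. Qed.
Fact quot_scaleDr : right_distributive quot_scale +%R.
Proof.
move=> a p q; rewrite -[p]quot_proj_repr -[q]quot_proj_repr -raddfD.
by rewrite !quot_scaleE scalerDr raddfD.
Qed.
Fact quot_scaleDl q : {morph quot_scale^~ q : a b / a + b}.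
Proof.
by move=> a b; rewrite -[q]quot_proj_repr !quot_scaleE scalerDl raddfD.
Qed.
HB.instance Definition _ := GRing.Zmodule_isLmodule.Build K quot_space
  quot_scaleA quot_scale1 quot_scaleDr quot_scaleDl.

Fact quot_proj_scalable : scalable quot_proj.
Proof. by move=> a v; rewrite -quot_scaleE. Qed.
HB.instance Definition _ :=
  GRing.isScalable.Build K V quot_space *:%R quot_proj quot_proj_scalable.

End QuotientSpace.

Section Cohomology.
Variable K : fieldType.

(* [d \o d = 0] is the separate predicate [is_complex], so that               *)
(* [cohomology] is defined as ker d / (im d :&: ker d).                        *)
Record cochains := Cochains {
  coch :> nat -> lmodType K;
  diff : forall n, {linear coch n -> coch n.+1}
}.

Definition is_complex (C : cochains) : Prop :=
  forall n (x : C n), diff C n.+1 (diff C n x) = 0.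

Variables (C : cochains) (n : nat).

Definition is_cocycle : {pred C n} := fun x => diff C n x == 0.
Fact is_cocycle_submod : subsemimod_closed is_cocycle.
Proof.
split; first split.
- by apply/eqP; rewrite raddf0.
- by move=> x y /eqP x0 /eqP y0; apply/eqP; rewrite linearD x0 y0 addr0.
- by move=> a x /eqP x0; apply/eqP; rewrite linearZZ /= x0 scaler0.
Qed.
HB.instance Definition _ :=
  GRing.isSubmodClosed.Build K (C n) is_cocycle is_cocycle_submod.

Record cocycle := Cocycle { cocycle_val :> C n; _ : cocycle_val \in is_cocycle }.
HB.instance Definition _ := [isSub for cocycle_val].
HB.instance Definition _ := [Choice of cocycle by <:].
HB.instance Definition _ := [SubChoice_isSubLmodule of cocycle by <:].

Definition coboundaryP (x : C n) : Prop :=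
  match n return C n -> Prop with
  | 0 => fun x => x = 0
  | m.+1 => fun x => exists y : C m, diff C m y = x
  end x.

Definition is_coboundary : {pred cocycle} :=
  fun z => `[< coboundaryP (cocycle_val z) >].
Fact is_coboundary_submod : subsemimod_closed is_coboundary.
Proof.
rewrite /is_coboundary /coboundaryP; split; first split.
- apply/asboolP => /=; case: (n) => // m.
  by exists 0; rewrite raddf0.
- move=> z t /asboolP zP /asboolP tP; apply/asboolP.
  rewrite [cocycle_val _](_ : _ = cocycle_val z + cocycle_val t) //.
  move: zP tP; move: (cocycle_val z) (cocycle_val t); case: (n) => [|m] x y.
    by move=> -> ->; rewrite addr0.
  by move=> [u <-] [v <-]; exists (u + v); rewrite linearD.
- move=> a z /asboolP zP; apply/asboolP.
  rewrite [cocycle_val _](_ : _ = a *: cocycle_val z) //; move: zP.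
  move: (cocycle_val z); case: (n) => [|m] x.
    by move=> ->; rewrite scaler0.
  by move=> [u <-]; exists (a *: u); rewrite linearZZ.
Qed.
HB.instance Definition _ :=
  GRing.isSubmodClosed.Build K cocycle is_coboundary is_coboundary_submod.

Definition cohomology : lmodType K := quot_space is_coboundary.
Definition cls : {linear cocycle -> cohomology} := @quot_proj K cocycle is_coboundary.

End Cohomology.

Section Multilinear.
Variables (K : fieldType) (V : lmodType K).

Definition set_arg n (v : {ffun 'I_n -> V}) (i : 'I_n) (x : V) :
  {ffun 'I_n -> V} := [ffun k => if k == i then x else v k].

Definition multilinear n (f : {ffun 'I_n -> V} -> V) : Prop :=
  forall v i, linear (fun x => f (set_arg v i x)).

Variable n : nat.

Definition is_multilinear : {pred ({ffun 'I_n.+1 -> V} -> V)} :=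
  fun f => `[< multilinear f >].
Fact is_multilinear_submod : subsemimod_closed is_multilinear.
Proof.
split; first split.
- by apply/asboolP => v i a x y; rewrite /= scaler0 addr0.
- move=> f g /asboolP fP /asboolP gP; apply/asboolP => v i a x y.
  rewrite -[LHS]/(f _ + g _) -[in RHS]/(f _ + g _) -[X in _ = _ + X]/(f _ + g _).
  by rewrite fP gP scalerDr addrACA.
- move=> a f /asboolP fP; apply/asboolP => v i b x y.
  rewrite -[LHS]/(a *: f _) -[in RHS]/(a *: f _) -[X in _ = _ + X]/(a *: f _).
  by rewrite fP scalerDr !scalerA mulrC.
Qed.
HB.instance Definition _ := GRing.isSubmodClosed.Build K
  ({ffun 'I_n.+1 -> V} -> V) is_multilinear is_multilinear_submod.

(* Hom(V^{(x) n+1}, V), indexed by its degree [n] for the Gerstenhaber        *)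
(* bracket.                                                                   *)
Record hom := Hom {
  hom_fun :> {ffun 'I_n.+1 -> V} -> V;
  _ : hom_fun \in is_multilinear
}.
HB.instance Definition _ := [isSub for hom_fun].
HB.instance Definition _ := [Choice of hom by <:].
HB.instance Definition _ := [SubChoice_isSubLmodule of hom by <:].

Lemma homP (f : hom) : multilinear f.
Proof. by case: f => f /= /asboolP. Qed.

Lemma hom_ext (f g : hom) : f =1 g -> f = g.
Proof. by move=> fg; apply: val_inj; apply: funext. Qed.

Lemma homPE (f : hom) (v : {ffun 'I_n.+1 -> V}) i a x y :
  f (set_arg v i (a *: x + y)) = a *: f (set_arg v i x) + f (set_arg v i y).
Proof. exact: homP. Qed.

Lemma hom0 (f : hom) (v : {ffun 'I_n.+1 -> V}) i : v i = 0 -> f v = 0.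
Proof.
move=> vi0; have {1}-> : v = set_arg v i (0 *: 0 + 0).
  by apply/ffunP => k; rewrite ffunE; case: eqP => // ->; rewrite vi0 scaler0 addr0.
have e : set_arg v i 0 = v.
  by apply/ffunP => k; rewrite ffunE; case: eqP => // ->; rewrite vi0.
by have := homPE f v i (-1) 0 0; rewrite scaler0 scale0r addr0 e scaleN1r addNr.
Qed.

End Multilinear.

Section Gerstenhaber.
Variables (K : fieldType) (V : lmodType K).

(* The argument list of the [i]-th term of [f <> g]: the block of [n.+1]      *)
(* consecutive entries of [v] starting at [i] is replaced by its image by     *)
(* [g]; all the uses of [inord] are in range when [p = m + n].                *)
Definition block n p (v : {ffun 'I_p.+1 -> V}) (i : nat) :
  {ffun 'I_n.+1 -> V} := [ffun j : 'I_n.+1 => v (inord (i + j))].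

Definition insert m n p (g : {ffun 'I_n.+1 -> V} -> V)
    (v : {ffun 'I_p.+1 -> V}) (i : nat) : {ffun 'I_m.+1 -> V} :=
  [ffun k : 'I_m.+1 => if (k < i)%N then v (inord k)
             else if (k == i :> nat) then g (block n v i)
             else v (inord (k + n))].

Definition circ m n p (f : {ffun 'I_m.+1 -> V} -> V)
    (g : {ffun 'I_n.+1 -> V} -> V) (v : {ffun 'I_p.+1 -> V}) : V :=
  \sum_(i < m.+1) (-1) ^+ (i * n) *: f (insert m g v i).

Lemma insertE m n p (g : {ffun 'I_n.+1 -> V} -> V) (v : {ffun 'I_p.+1 -> V}) i
    (k : 'I_m.+1) :
  insert m g v i k = if (k < i)%N then v (inord k)
             else if (k == i :> nat) then g (block n v i)
             else v (inord (k + n)).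
Proof. by rewrite ffunE. Qed.

Lemma blockE n p (v : {ffun 'I_p.+1 -> V}) i (j : 'I_n.+1) :
  block n v i j = v (inord (i + j)).
Proof. by rewrite ffunE. Qed.

Lemma set_argE n (v : {ffun 'I_n -> V}) q x k :
  set_arg v q x k = if k == q then x else v k.
Proof. by rewrite ffunE. Qed.

Lemma set_arg_inord p (v : {ffun 'I_p.+1 -> V}) (q : 'I_p.+1) x t :
  (t <= p)%N ->
  set_arg v q x (inord t) = if t == q then x else v (inord t).
Proof. by move=> tp; rewrite ffunE -val_eqE /= inordK. Qed.

Lemma set_arg_id n (v : {ffun 'I_n -> V}) i : set_arg v i (v i) = v.
Proof. by apply/ffunP => k; rewrite ffunE; case: eqP => // ->. Qed.

Lemma circ_multilinear m n p (f : hom V m) (g : hom V n) :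
  p = (m + n)%N -> multilinear (@circ m n p f g).
Proof.
move=> e v q a x y; rewrite /circ scaler_sumr -big_split /=; apply: eq_bigr => i _.
rewrite scalerA mulrC -scalerA -scalerDr; congr (_ *: _).
have ltiS := ltn_ord i; have ltqS := ltn_ord q.
have [qi|iq] := ltnP q i.
  have h z : insert m g (set_arg v q z) i = set_arg (insert m g v i) (inord q) z.
    apply/ffunP => k; have ltk := ltn_ord k.
    rewrite set_argE !insertE -val_eqE /= inordK; last by lia.
    rewrite !set_arg_inord; try lia.
    have [ki|ik] := ltnP k i; first by [].
    have [ki|nki] := eqVneq (k : nat) i.
      rewrite ki gtn_eqF //; congr (g _); apply/ffunP => j; have ltj := ltn_ord j.
      by rewrite !blockE set_arg_inord; try lia; rewrite gtn_eqF //; lia.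
    by rewrite gtn_eqF ?gtn_eqF //; lia.
  by rewrite !h homPE.
have [qin|inq] := leqP q (i + n).
  have h z : insert m g (set_arg v q z) i =
      set_arg (insert m g v i) i (g (set_arg (block n v i) (inord (q - i)) z)).
    apply/ffunP => k; have ltk := ltn_ord k.
    rewrite set_argE !insertE -val_eqE /=.
    have [ki|ik] := ltnP k i.
      by rewrite set_arg_inord; try lia; rewrite !ltn_eqF //; lia.
    have [ki|nki] := eqVneq (k : nat) i.
      congr (g _); apply/ffunP => j; have ltj := ltn_ord j.
      rewrite set_argE !blockE set_arg_inord; try lia.
      rewrite -val_eqE /= inordK; try lia.
      by have -> : ((i + j)%N == q) = ((j : nat) == (q - i)%N) by lia.
    by rewrite set_arg_inord; try lia; rewrite gtn_eqF //; lia.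
  by rewrite !h !homPE.
have h z : insert m g (set_arg v q z) i = set_arg (insert m g v i) (inord (q - n)) z.
  apply/ffunP => k; have ltk := ltn_ord k.
  rewrite set_argE !insertE -val_eqE /= inordK; last by lia.
  have [ki|ik] := ltnP k i.
    by rewrite set_arg_inord; try lia; rewrite !ltn_eqF //; lia.
  have [ki|nki] := eqVneq (k : nat) i.
    rewrite ki ltn_eqF; try lia; congr (g _); apply/ffunP => j.
    have ltj := ltn_ord j.
    by rewrite !blockE set_arg_inord; try lia; rewrite ltn_eqF //; lia.
  rewrite set_arg_inord; try lia.
  by have -> : ((k + n)%N == q) = ((k : nat) == (q - n)%N) by lia.
by rewrite !h homPE.
Qed.

Definition gerst_fun m n (f : hom V m) (g : hom V n)
    (v : {ffun 'I_(m + n).+1 -> V}) : V :=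
  circ f g v - (-1) ^+ (m * n) *: circ g f v.

Fact gerst_subproof m n (f : hom V m) (g : hom V n) :
  gerst_fun f g \in @is_multilinear K V (m + n).
Proof.
apply/asboolP => v i a x y; rewrite /gerst_fun.
have -> := circ_multilinear f g erefl v i a x y.
have -> := circ_multilinear g f (addnC m n) v i a x y.
rewrite scalerBr scalerDr opprD addrACA; congr (_ - _ + _).
by rewrite !scalerA mulrC.
Qed.
Definition gerst m n (f : hom V m) (g : hom V n) : hom V (m + n) :=
  Hom (gerst_subproof f g).

Lemma circ_linr m n p (f : hom V m) (g h : {ffun 'I_n.+1 -> V} -> V) a
    (v : {ffun 'I_p.+1 -> V}) :
  circ f (fun u => a *: g u + h u) v = a *: circ f g v + circ f h v.
Proof.
rewrite /circ scaler_sumr -big_split /=; apply: eq_bigr => i _.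
rewrite scalerA mulrC -scalerA -scalerDr; congr (_ *: _).
have e (g' : {ffun 'I_n.+1 -> V} -> V) :
    insert m g' v i = set_arg (insert m g v i) i (g' (block n v i)).
  apply/ffunP => k; rewrite !ffunE -val_eqE /=.
  by case: ltngtP.
by rewrite (e (fun u => a *: g u + h u)) homPE -(e g) -(e h).
Qed.

Lemma circ_linl m n p (g h : {ffun 'I_m.+1 -> V} -> V) (f : hom V n) a
    (v : {ffun 'I_p.+1 -> V}) :
  circ (fun u => a *: g u + h u) f v = a *: circ g f v + circ h f v.
Proof.
rewrite /circ scaler_sumr -big_split /=; apply: eq_bigr => i _.
by rewrite scalerA mulrC -scalerA -scalerDr.
Qed.

Lemma gerst_linear m n (f : hom V m) : linear (@gerst m n f).
Proof.
move=> a g h; apply: hom_ext => v.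
rewrite -[RHS]/(a *: gerst_fun f g v + gerst_fun f h v) /= /gerst_fun.
have -> := circ_linr f g h a v; have -> := circ_linl g h f a v.
rewrite scalerBr scalerDr opprD addrACA; congr (_ - _ + _).
by rewrite !scalerA mulrC.
Qed.

End Gerstenhaber.

Section Weight.
Variables (K : fieldType) (A M : lmodType K).
Local Notation V := (A * M)%type.

(* [v] is a list of arguments from [A] (outside [S]) and from [M] (in [S]).   *)
Definition pure n (S : {set 'I_n}) (v : {ffun 'I_n -> V}) : Prop :=
  forall k, if k \in S then (v k).1 = 0 else (v k).2 = 0.

Definition in_weight (c s : nat) (x : V) : Prop :=
  if s == c then x.2 = 0 else if s == c.+1 then x.1 = 0 else x = 0.

(* [f] takes values in [A] on arguments with exactly [c] entries from [M],    *)
(* values in [M] on arguments with exactly [c.+1] entries from [M], and is    *)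
(* zero on the other ones. For [c = 0] this describes, inside Hom(V^n, V),    *)
(* Hom(A^n, A) (+) Hom(A^{n-1,1}, M), and for [c = n] it describes            *)
(* Hom(M^n, A), in both cases with the maps extended by zero.                 *)
Definition has_weight c n (f : {ffun 'I_n -> V} -> V) : Prop :=
  forall S v, pure S v -> in_weight c #|S| (f v).

Lemma in_weight0 c s : in_weight c s 0.
Proof. by rewrite /in_weight; case: ifP => // _; case: ifP. Qed.

Lemma in_weightD c s x y : in_weight c s x -> in_weight c s y ->
  in_weight c s (x + y).
Proof.
rewrite /in_weight; case: ifP => _ /=; first by move=> -> ->; rewrite addr0.
by case: ifP => _ /= -> ->; rewrite addr0.
Qed.

Lemma in_weightZ c s a x : in_weight c s x -> in_weight c s (a *: x).
Proof.
rewrite /in_weight; case: ifP => _ /=; first by move=> ->; rewrite scaler0.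
by case: ifP => _ /= ->; rewrite scaler0.
Qed.

Section WeightHom.
Variables (c n : nat).

Definition is_weight : {pred hom V n} := fun f => `[< has_weight c f >].
Fact is_weight_submod : subsemimod_closed is_weight.
Proof.
split; first split.
- by apply/asboolP => S v _; exact: in_weight0.
- move=> f g /asboolP fP /asboolP gP; apply/asboolP => S v vS.
  by apply: in_weightD; [exact: fP | exact: gP].
- move=> a f /asboolP fP; apply/asboolP => S v vS.
  by apply: in_weightZ; exact: fP.
Qed.
HB.instance Definition _ :=
  GRing.isSubmodClosed.Build K (hom V n) is_weight is_weight_submod.

Record whom := WHom { whom_val :> hom V n; _ : whom_val \in is_weight }.
HB.instance Definition _ := [isSub for whom_val].
HB.instance Definition _ := [Choice of whom by <:].
HB.instance Definition _ := [SubChoice_isSubLmodule of whom by <:].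

Lemma whomP (f : whom) : has_weight c f.
Proof. by case: f => f /= /asboolP. Qed.

Lemma whom_ext (f g : whom) : f =1 g -> f = g.
Proof. by move=> fg; apply: val_inj; apply: hom_ext. Qed.

End WeightHom.

Lemma insert_card m n p (i : 'I_m.+1) (S : {set 'I_p.+1}) (b : bool) :
  p = (m + n)%N ->
  (#|[set k : 'I_m.+1 | if (k < i)%N then inord k \in S
      else if k == i then b else inord (k + n) \in S]|
   + #|[set j : 'I_n.+1 | inord (i + j) \in S]| = #|S| + b)%N.
Proof.
move=> e; have lti := ltn_ord i; pose s q : nat := (inord q : 'I_p.+1) \in S.
have cardE N (P : pred 'I_N) (F : nat -> nat) : (forall k : 'I_N, P k = F k :> nat) ->
    #|[set k | P k]| = (\sum_(0 <= k < N) F k)%N.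
  move=> h; rewrite cardsE -sum1_card big_mkord [RHS](eq_bigr (fun k => P k : nat)).
    by rewrite big_mkcond; apply: eq_bigr => k _; rewrite unfold_in; case: (P k).
  by move=> k _; rewrite h.
pose t k := (if k < i then s k else if k == i then (b : nat) else s (k + n))%N.
rewrite (cardE _ _ t); last by move=> k; rewrite /t -val_eqE; case: ifP => // _; case: ifP.
rewrite (cardE _ _ (fun j => s (i + j)%N)) //.
have -> : #|S| = (\sum_(0 <= q < p.+1) s q)%N.
  by rewrite -(cardE _ (mem S)) ?cardsE // => k; rewrite /s inord_val.
rewrite (@big_cat_nat _ _ _ i 0 m.+1) //=; last by lia.
rewrite (@big_cat_nat _ _ _ i 0 p.+1) //=; last by lia.
rewrite (@big_cat_nat _ _ _ (i + n.+1) i p.+1) //=; try lia.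
rewrite (@big_ltn _ _ _ i m.+1) //.
have -> : (\sum_(0 <= k < i) t k = \sum_(0 <= k < i) s k)%N.
  by apply: eq_big_nat => k /andP[_ ki]; rewrite /t ki.
have -> : t i = b by rewrite /t ltnn eqxx.
have -> : (\sum_(i.+1 <= k < m.+1) t k = \sum_(i + n.+1 <= q < p.+1) s q)%N.
  have -> : (i + n.+1 = i.+1 + n)%N by lia.
  rewrite big_addn; have -> : (p.+1 - n = m.+1)%N by lia.
  apply: eq_big_nat => k /andP[ik _]; rewrite /t.
  by rewrite ltnNge (ltnW ik) /= gtn_eqF.
have -> : (\sum_(0 <= j < n.+1) s (i + j) = \sum_(i <= q < i + n.+1) s q)%N.
  rewrite -{2}[val i]add0n big_addn addKn.
  by apply: eq_bigr => j _; rewrite addnC.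
by lia.
Qed.

Lemma circ_weight (c d : nat) m n p (f : {ffun 'I_m.+1 -> V} -> V)
    (g : {ffun 'I_n.+1 -> V} -> V) :
  p = (m + n)%N -> (forall (v : {ffun 'I_m.+1 -> V}) k, v k = 0 -> f v = 0) ->
  has_weight c f -> has_weight d g -> has_weight (c + d) (@circ K _ m n p f g).
Proof.
move=> e f0 fP gP S v vS; rewrite /circ.
apply: big_ind => [||i _]; [exact: in_weight0 | exact: in_weightD |].
apply: in_weightZ.
set Sb := [set j : 'I_n.+1 | inord (i + j) \in S].
have pb : pure Sb (block n v i).
  by move=> j; rewrite blockE inE; exact: vS.
pose Sw b := [set k : 'I_m.+1 | if (k < i)%N then inord k \in S
      else if k == i then b else inord (k + n) \in S].
have cSw b : (#|Sw b| + #|Sb| = #|S| + b)%N by exact: insert_card.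
have pw b : (if b then (g (block n v i)).1 = 0 else (g (block n v i)).2 = 0) ->
    pure (Sw b) (insert m g v i).
  move=> gb k; rewrite insertE inE -val_eqE /=.
  case: (ltnP k i) => ki; first exact: vS.
  by case: eqP => _; [case: (b) gb | exact: vS].
have := gP _ _ pb; rewrite {1}/in_weight.
case: eqP => [sb g2|_].
  have := fP _ _ (pw false g2); rewrite /in_weight.
  have := cSw false; rewrite sb addn0 => <-.
  by rewrite -addSn !eqn_add2r.
case: eqP => [sb g1|_ g0].
  have := fP _ _ (pw true g1); rewrite /in_weight.
  have := cSw true; rewrite sb addn1 addnS => -[<-].
  by rewrite -addSn !eqn_add2r.
rewrite (f0 _ i); first exact: in_weight0.
by rewrite insertE ltnn eqxx.
Qed.

Fact wgerst_subproof c d m n (f : whom c m) (g : whom d n) :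
  gerst f g \in @is_weight (c + d) (m + n).
Proof.
apply/asboolP => S v vS /=; apply: in_weightD.
  by apply: (circ_weight _ _ (whomP f) (whomP g)) => // w k; exact: hom0.
rewrite -scaleN1r; do 2! apply: in_weightZ; rewrite addnC.
apply: (circ_weight _ _ (whomP g) (whomP f)) => //; first exact: addnC.
by move=> w k; exact: hom0.
Qed.
Definition wgerst c d m n (f : whom c m) (g : whom d n) :
  whom (c + d) (m + n) := WHom (wgerst_subproof f g).

Fact wgerst_linear c d m n (f : whom c m) : linear (@wgerst c d m n f).
Proof. by move=> a g h; apply: val_inj; exact: gerst_linear. Qed.
HB.instance Definition _ c d m n (f : whom c m) :=
  GRing.isLinear.Build K (whom d n) (whom (c + d) (m + n)) *:%R
    (@wgerst c d m n f) (@wgerst_linear c d m n f).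

End Weight.

(* [A] is not assumed to be unital, so its product is a bilinear map on a     *)
(* vector space rather than the product of an [algType].                      *)
Record relRB (K : fieldType) (A M : lmodType K) := RelRB {
  rb_mul : {bilinear A -> A -> A};
  rb_left : {bilinear A -> M -> M};
  rb_right : {bilinear M -> A -> M};
  rb_op : {linear M -> A};
  rb_mulA : forall a b c, rb_mul a (rb_mul b c) = rb_mul (rb_mul a b) c;
  rb_leftA : forall a b m, rb_left (rb_mul a b) m = rb_left a (rb_left b m);
  rb_midA : forall a m b,
    rb_right (rb_left a m) b = rb_left a (rb_right m b);
  rb_rightA : forall m a b,
    rb_right m (rb_mul a b) = rb_right (rb_right m a) b;
  rb_opM : forall m n, rb_mul (rb_op m) (rb_op n) =
    rb_op (rb_left (rb_op m) n + rb_right m (rb_op n))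
}.

Section Complexes.
Variables (K : fieldType) (A M : lmodType K) (R : relRB A M).
Local Notation V := (A * M)%type.
Local Notation whom := (whom A M).
Local Notation T := (rb_op R).

Definition pi_fun (v : {ffun 'I_2 -> V}) : V :=
  let x := v ord0 in let y := v ord_max in
  (rb_mul R x.1 y.1, rb_left R x.1 y.2 + rb_right R x.2 y.1).

Fact pi_multilinear : pi_fun \in @is_multilinear K V 1.
Proof.
apply/asboolP => v i a x y; rewrite /pi_fun !set_argE.
have [->|->] : i = ord0 \/ i = ord_max.
- by case: i => [[|[|//]]] ?; [left | right]; exact: val_inj.
- rewrite /= !linearPl; congr pair => /=.
  by rewrite scalerDr addrACA.
- rewrite /= !linearPr; congr pair => /=.
  by rewrite scalerDr addrACA.
Qed.
Definition pi_hom : hom V 1 := Hom pi_multilinear.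

Fact pi_weight : pi_hom \in @is_weight K A M 0 1.
Proof.
apply/asboolP => S v vS /=; rewrite /in_weight /pi_fun.
have -> : #|S| = ((ord0 \in S) + (ord_max \in S))%N.
  rewrite -sum1_card big_mkcond big_ord_recl big_ord1 /=.
  have -> : lift ord0 ord0 = ord_max :> 'I_2 by exact: val_inj.
  by do 2 case: (_ \in S).
have := vS ord0; have := vS ord_max.
by case: (ord0 \in S); case: (ord_max \in S) => /= y0 x0;
  rewrite ?x0 ?y0 ?(linear0l, linear0r) ?addr0.
Qed.
Definition pi_whom : whom 0 1 := WHom pi_weight.

Definition Text (x : V) : V := (T x.2, 0).

Fact Text_linear : linear Text.
Proof.
by move=> a x y; rewrite /Text linearP; congr pair; rewrite /= scaler0 addr0.
Qed.
HB.instance Definition _ := GRing.isLinear.Build K V V *:%R Text Text_linear.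

Fact T_multilinear : (fun v : {ffun 'I_1 -> V} => Text (v ord0))
  \in @is_multilinear K V 0.
Proof. by apply/asboolP => v i a x y; rewrite !set_argE (ord1 i) /= linearP. Qed.
Definition T_hom : hom V 0 := Hom T_multilinear.

Fact T_weight : T_hom \in @is_weight K A M 1 0.
Proof.
apply/asboolP => S v vS /=; rewrite /in_weight /Text /=; case: eqP => // S1.
have : ord0 \notin S.
  apply/negP => S0; apply: S1; have -> : S = setT.
    by apply/setP => k; rewrite (ord1 k) S0 inE.
  by rewrite cardsT card_ord.
by have := vS ord0; case: ifP => // _ -> _; rewrite linear0; case: ifP.
Qed.
Definition T_whom : whom 1 0 := WHom T_weight.

(* C^n(T) = Hom(M^{n-1}, A) sits in degree [n - 2] of the Gerstenhaber        *)
(* algebra, and C^n(A, M) in degree [n - 1].                                  *)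
Definition d_T k (P : whom k.+1 k) : whom k.+2 k.+1 :=
  wgerst (wgerst pi_whom T_whom) P.
Fact d_T_linear k : linear (@d_T k). 
Proof. by move=> a f g; exact: (wgerst_linear (wgerst pi_whom T_whom)). Qed.
HB.instance Definition _ k := GRing.isLinear.Build K (whom k.+1 k)
  (whom k.+2 k.+1) *:%R (@d_T k) (@d_T_linear k).

Definition CT_coch (n : nat) : lmodType K :=
  match n with k.+2 => whom k.+1 k | _ => 'rV[K]_0 end.

Definition CT_diff (n : nat) : {linear CT_coch n -> CT_coch n.+1} :=
  match n return {linear CT_coch n -> CT_coch n.+1} with
  | k.+2 => @d_T k
  | _ => \0
  end.

Definition CT : cochains K := Cochains CT_diff.

Definition d_AM k (f : whom 0 k) : whom 0 k.+1 :=
  (-1) ^+ k *: (wgerst pi_whom f : whom 0 k.+1).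
Fact d_AM_linear k : linear (@d_AM k).
Proof.
move=> a f g; rewrite /d_AM (wgerst_linear pi_whom a f g) scalerDr !scalerA.
by rewrite mulrC.
Qed.
HB.instance Definition _ k := GRing.isLinear.Build K (whom 0 k)
  (whom 0 k.+1) *:%R (@d_AM k) (@d_AM_linear k).

Definition CAM_coch (n : nat) : lmodType K :=
  match n with k.+1 => whom 0 k | 0 => 'rV[K]_0 end.

Definition CAM_diff (n : nat) : {linear CAM_coch n -> CAM_coch n.+1} :=
  match n return {linear CAM_coch n -> CAM_coch n.+1} with
  | k.+1 => @d_AM k
  | 0 => \0
  end.

Definition CAM : cochains K := Cochains CAM_diff.

(* With [Text] vanishing on [A], this formula, evaluated on arguments from    *)
(* A (+) M, is the extension by zero of [Omega f].                            *)
Definition Omega_fun k (f : {ffun 'I_k.+1 -> V} -> V)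
    (u : {ffun 'I_k.+1 -> V}) : V :=
  (-1) ^+ k.+1 *: (f [ffun j => Text (u j)]
    - \sum_(i < k.+1) Text (f [ffun j => if j == i then u j else Text (u j)])).

Fact Omega_multilinear k (f : hom V k) : Omega_fun f \in @is_multilinear K V k.
Proof.
apply/asboolP => v q a x y; rewrite /Omega_fun.
rewrite scalerA mulrC -scalerA -scalerDr; congr (_ *: _).
rewrite scalerBr addrACA -opprD scaler_sumr -big_split /=; congr (_ - _).
  have h z : [ffun j => Text (set_arg v q z j)] =
      set_arg [ffun j => Text (v j)] q (Text z).
    by apply/ffunP => j; rewrite !ffunE; case: eqP.
  by rewrite !h linearP homPE.
apply: eq_bigr => i _; rewrite -linearP; congr Text.
pose w := [ffun j => if j == i then v j else Text (v j)].
have h z : [ffun j => if j == i then set_arg v q z j else Text (set_arg v q z j)] =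
    set_arg w q (if q == i then z else Text z).
  apply/ffunP => j; rewrite !ffunE.
  by have [->|ji] := eqVneq j q; case: eqP.
by rewrite !h; case: eqP => _; rewrite ?linearP homPE.
Qed.
Definition Omega_hom k (f : hom V k) : hom V k := Hom (Omega_multilinear f).

Fact Omega_weight k (f : whom 0 k) : Omega_hom f \in @is_weight K A M k.+1 k.
Proof.
have f0 (v : {ffun 'I_k.+1 -> V}) : (forall j, (v j).2 = 0) -> (f v).2 = 0.
  move=> v0; have : pure set0 v by move=> j; rewrite inE.
  by move=> /(whomP f); rewrite /in_weight cards0.
apply/asboolP => S v vS /=; apply: in_weightZ; rewrite /in_weight.
have [_|Sk] := eqVneq #|S| k.+1.
  rewrite /= f0 ?sub0r => [|j]; last by rewrite ffunE.
  by rewrite (raddf_sum snd) big1 ?oppr0.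
have : (#|S| <= k.+1)%N by have := max_card (mem S); rewrite card_ord.
rewrite leq_eqVlt (negPf Sk) /= => ltS; rewrite ltn_eqF; last by lia.
have [j jS] : exists j, j \notin S.
  apply/existsP; rewrite -negb_forall; apply: contraTN ltS => /forallP Sall.
  have -> : S = setT by apply/setP => x; rewrite inE; exact: Sall.
  by rewrite cardsT card_ord ltnn.
have vj : (v j).2 = 0 by have := vS j; rewrite (negPf jS).
have Tj : Text (v j) = 0 by rewrite /Text vj linear0.
rewrite (@hom0 K _ k f _ j) ?ffunE // sub0r big1 ?oppr0 // => i _.
have [->|ji] := eqVneq i j.
  rewrite /Text f0 ?linear0 // => l; rewrite ffunE.
  by case: eqP => // ->.
by rewrite (@hom0 K _ k f _ j) ?linear0 // ffunE eq_sym (negPf ji).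
Qed.
Definition Omega_whom k (f : whom 0 k) : whom k.+1 k := WHom (Omega_weight f).

Fact Omega_whom_linear k : linear (@Omega_whom k).
Proof.
move=> a f g; apply: whom_ext => v.
rewrite -[RHS]/(a *: Omega_fun f v + Omega_fun g v) /= /Omega_fun.
rewrite [in RHS]scalerA mulrC -scalerA -scalerDr; congr (_ *: _).
rewrite scalerBr addrACA -opprD scaler_sumr -big_split /=; congr (_ - _).
by apply: eq_bigr => i _; rewrite -linearP.
Qed.
HB.instance Definition _ k :=
  GRing.isLinear.Build K (whom 0 k) (whom k.+1 k) *:%R (@Omega_whom k)
    (@Omega_whom_linear k).

Definition Omega (n : nat) : {linear CAM_coch n -> CT_coch n.+1} :=
  match n return {linear CAM_coch n -> CT_coch n.+1} with
  | k.+1 => @Omega_whom k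
  | 0 => \0
  end.

(* In degree 1 the component [P] lives in C^1(T) = 0.                         *)
Definition CAMT_coch (n : nat) : lmodType K := (CAM n * CT n)%type.

Definition CAMT_diff_fun (n : nat) (x : CAMT_coch n) : CAMT_coch n.+1 :=
  (diff CAM n x.1, (-1) ^+ n *: diff CT n x.2 + Omega n x.1).

Fact CAMT_diff_linear n : linear (@CAMT_diff_fun n).
Proof.
move=> a x y; rewrite /CAMT_diff_fun !linearP; congr pair => /=.
by rewrite !scalerDr !scalerA mulrC addrACA.
Qed.
HB.instance Definition _ n :=
  GRing.isLinear.Build K (CAMT_coch n) (CAMT_coch n.+1) *:%R (@CAMT_diff_fun n)
    (@CAMT_diff_linear n).

Definition CAMT : cochains K := @Cochains K CAMT_coch (fun n => @CAMT_diff_fun n).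

Definition inclT (n : nat) (P : CT n) : CAMT n := (0, P).
Definition projAM (n : nat) (x : CAMT n) : CAM n := x.1.

End Complexes.

(* [h] is well defined on classes by [h [z] = [g z]]; in particular [g] maps  *)
(* cocycles to cocycles.                                                      *)
Definition induced_by (K : fieldType) (C D : cochains K) (n m : nat)
    (g : C n -> D m) (h : cohomology C n -> cohomology D m) : Prop :=
  forall z : cocycle C n,
    exists2 w : cocycle D m, w = g z :> D m & h (cls C n z) = cls D m w.

Definition exact_at (K : fieldType) (U V W : lmodType K)
    (f : U -> V) (g : V -> W) : Prop :=
  forall y, g y = 0 <-> exists x, f x = y.

(* Main.v *)
From HB Require Import structures.
From mathcomp Require Import all_boot all_order all_algebra.
From mathcomp Require Import boolp zify.
Require Import Defs.
Set Implicit Arguments.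
Unset Strict Implicit.
Unset Printing Implicit Defensive.
Import GRing.Theory.
Local Open Scope ring_scope.

(* Let [phi = 1 + T], an automorphism of [A (+) M] with inverse [1 - T], and  *)
(* let [f^phi = phi^-1 o f o (phi, ..., phi)]. Conjugation by [phi] preserves *)
(* the Gerstenhaber bracket. The Rota-Baxter identity says that               *)
(* [pi^phi = pi + [pi, T]], and [Omega f] is, up to the sign [(-1) ^ n], the  *)
(* component of [f^phi] in Hom(M^n, A). Taking this component of              *)
(* [[pi, f]^phi = [pi^phi, f^phi]] gives                                      *)
(* [Omega (d f) = (-1) ^ n d_T (Omega f)]. Together with the associativity of *)
(* [pi] and [[pi, T]], which makes bracketing with either of them square to   *)
(* zero, this turns C(A, M, T) into the mapping cone of [Omega], whose long   *)
(* exact sequence is the one of the theorem.                                  *)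

(** In the cone, a pair (f, P) of degree n is a cocycle exactly when d f = 0 and Omega f = - (-1)^n
    d_T P. Hence a class [f] lifts to the cone iff Omega f is a coboundary, and [P] dies in the cone
    iff it equals some [Omega g] with g a cocycle. This is exactness, with [f] -> [Omega f] as
    connecting map ([exact_incl_proj], [exact_proj_connecting], [exact_connecting_incl]). The
    algebraic content is [Omega_d_AM], which rests on [ev_circ_shear_conj] (conjugation respects
    insertion), [shear_conj_piE] (the Rota-Baxter identity) and [Omega_shear_conj] (Omega f as a
    component of a conjugate). The differentials square to zero by [gerst_gerst_binop], applied to
    the associative products of [binop_pi_homA] and [binop_pi_TA]. *)

Lemma sum_cancel (U : zmodType) n (t : nat -> nat -> U) :
  (forall i j, (j <= i)%N -> t i.+1 j = - t j i) ->
  \sum_(i < n.+1) \sum_(j < n) t i j = 0.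
Proof.
(* The index rectangle is cut along its diagonal; (i, j) -> (j, i.+1) matches the part on or above
   it with the part strictly below, with opposite signs. *)
move=> tS; pose lo i j := if (j < i)%N then t i j else 0.
pose hi i j := if (i <= j)%N then t i j else 0.
have -> : \sum_(i < n.+1) \sum_(j < n) t i j =
    \sum_(i < n.+1) \sum_(j < n) lo i j + \sum_(i < n.+1) \sum_(j < n) hi i j.
  rewrite -big_split; apply: eq_bigr => i _; rewrite -big_split.
  apply: eq_bigr => j _; rewrite /lo /hi /=; case: (ltnP j i) => _.
    by rewrite addr0.
  by rewrite add0r.
rewrite big_ord_recl big1 => [|j _]; last by rewrite /lo.
rewrite add0r big_ord_recr /= [X in _ + (_ + X)]big1 => [|j _]; last first.
  by rewrite /hi leqNgt ltn_ord.
rewrite addr0 [X in _ + X]exchange_big -big_split big1 //= => i _.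
rewrite -big_split big1 // => j _; rewrite /lo /hi /bump /= add1n ltnS.
by case: leqP => [/tS ->|]; rewrite ?addNr ?addr0.
Qed.

(** * Multilinear maps evaluated on sequences *)

Section SequenceArguments.
Variables (K : fieldType) (V : lmodType K).

(* Indexing the arguments by [nat] gets rid of the bounds of ['I_n.+1]. *)
Definition ev n (f : {ffun 'I_n.+1 -> V} -> V) (w : nat -> V) : V :=
  f [ffun k : 'I_n.+1 => w k].

Definition insert_seq n (g : {ffun 'I_n.+1 -> V} -> V) (i : nat)
    (w : nat -> V) (k : nat) : V :=
  if (k < i)%N then w k
  else if k == i then ev g (fun j => w (i + j)%N) else w (k + n)%N.

Lemma ev_ext n (f : {ffun 'I_n.+1 -> V} -> V) w w' :
  (forall k, (k <= n)%N -> w k = w' k) -> ev f w = ev f w'.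
Proof.
by move=> ww'; congr f; apply/ffunP => k; rewrite !ffunE ww' // -ltnS ltn_ord.
Qed.

Lemma ev_inord n (f : {ffun 'I_n.+1 -> V} -> V) v :
  f v = ev f (fun k => v (inord k)).
Proof. by congr f; apply/ffunP => k; rewrite ffunE inord_val. Qed.

(** With [p = m + n] every index stays in range, so each [inord] acts as the identity on values. *)
Lemma ev_circ m n p (f : {ffun 'I_m.+1 -> V} -> V)
    (g : {ffun 'I_n.+1 -> V} -> V) w : p = (m + n)%N ->
  ev (@circ _ _ m n p f g) w =
  \sum_(i < m.+1) (-1) ^+ (i * n) *: ev f (insert_seq g i w).
Proof.
move=> e; apply: eq_bigr => i _; congr (_ *: f _); apply/ffunP => k.
have ltk := ltn_ord k; have lti := ltn_ord i.
rewrite insertE !ffunE /insert_seq; case: ltnP => ki.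
  by rewrite inordK //; lia.
case: eqP => [_|ne]; last by rewrite inordK //; lia.
congr g; apply/ffunP => j; have ltj := ltn_ord j.
by rewrite blockE !ffunE inordK //; lia.
Qed.

End SequenceArguments.

(** * Bracketing with an associative product squares to zero *)

Section Hochschild.
Variables (K : fieldType) (V : lmodType K).

Definition binop (th : hom V 1) (x y : V) : V :=
  ev (n := 1) th (fun k => if k is 0 then x else y).

Fact binop_bilinear th : bilinear_for *:%R *:%R (binop th).
Proof.
split=> z a x y /=.
  have h t : binop th t z = th (set_arg [ffun=> z] ord0 t).
    by congr (th _); apply/ffunP => -[[|k] ltk]; rewrite !ffunE.
  by rewrite !h homPE.
have h t : binop th z t = th (set_arg [ffun=> z] ord_max t).
  by congr (th _); apply/ffunP => -[[|[|k]] ltk]; rewrite !ffunE.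
by rewrite !h homPE.
Qed.
HB.instance Definition _ th := bilinear_isBilinear.Build K V V V *:%R *:%R
  (binop th) (binop_bilinear th).

Lemma ev_binop (th : hom V 1) w : ev (n := 1) th w = binop th (w 0%N) (w 1%N).
Proof. by apply: ev_ext => -[|[|]]. Qed.

Variable th : hom V 1.

Lemma insert_binopE i w k : insert_seq th i w k =
  if (k < i)%N then w k
  else if k == i then binop th (w i) (w i.+1) else w k.+1.
Proof. by rewrite /insert_seq ev_binop addn0 !addn1. Qed.

(** Up to the sign (-1)^n, this is the Hochschild coboundary of [g] for the product [binop th]. *)
Lemma ev_gerst_binop n (g : hom V n) w :
  ev (n := n.+1) (gerst th g) w =
  binop th (ev g w) (w n.+1) + (-1) ^+ n *: binop th (w 0%N) (ev g (w \o S))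
  - (-1) ^+ n *: \sum_(i < n.+1) (-1) ^+ i *: ev g (insert_seq th i w).
Proof.
rewrite -[LHS]/(ev (n := n.+1) (circ th g) w
  - (-1) ^+ (1 * n) *: ev (n := n.+1) (circ g th) w).
rewrite !ev_circ ?addn1 // big_ord_recl big_ord1 mul1n; congr (_ - _).
  by rewrite scale1r !ev_binop.
by congr (_ *: _); apply: eq_bigr => i _; rewrite muln1.
Qed.

Hypothesis thA : associative (binop th).

(** A simplicial identity for contractions of neighbours: for [j < i] the two contractions concern
    disjoint pairs, and for [j = i] it is associativity. *)
Lemma insert_binopC i j w k : (j <= i)%N ->
  insert_seq th j (insert_seq th i.+1 w) k =
  insert_seq th i (insert_seq th j w) k.
Proof.
move=> ji; rewrite !insert_binopE.
repeat match goal with |- context [if ?b then _ else _] =>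
  case: (boolP b) => ?; try (exfalso; lia) end => //.
by have -> : i = j by lia.
Qed.

Lemma sum_insert_binop n (g : hom V n) w :
  \sum_(i < n.+2) (-1) ^+ i *: (\sum_(j < n.+1) (-1) ^+ j *:
    ev g (insert_seq th j (insert_seq th i w))) = 0.
Proof.
under eq_bigr => i _ do rewrite scaler_sumr.
pose t i j : V := (-1) ^+ i *: ((-1) ^+ j *:
  ev g (insert_seq th j (insert_seq th i w))).
rewrite (@sum_cancel _ _ t) // => i j ji.
rewrite /t !scalerA -!exprD addSn exprS mulN1r scaleNr addnC.
by congr (- (_ *: _)); apply: ev_ext => k _; exact: insert_binopC.
Qed.

Lemma gerst_gerst_binop n (g : hom V n) v :
  gerst th (gerst th g) v = 0.
Proof.
rewrite ev_inord; move: (fun k => _) => w.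
rewrite -/(ev (n := n.+2) _ w) (ev_gerst_binop (gerst th g)).
have -> : (-1) ^+ (1 + n) = - (-1) ^+ n :> K by rewrite exprS mulN1r.
have sg : (-1) ^+ n * (-1) ^+ n = 1 :> K by rewrite -expr2 sqrr_sign.
set e := (-1) ^+ n in sg *.
(* [C] and [F] collect the inner contractions multiplied by the last, respectively first, argument;
   [a], [b] and [d] have [g] at the left, in the middle and at the right of two free arguments. Each
   occurs twice, with opposite signs. *)
pose C := \sum_(i < n.+1) (-1) ^+ i *:
  binop th (ev g (insert_seq th i w)) (w n.+2).
pose F := \sum_(i < n.+1) (-1) ^+ i *:
  binop th (w 0%N) (ev g (insert_seq th i (w \o S))).
pose a := binop th (binop th (ev g w) (w n.+1)) (w n.+2).
pose b := binop th (binop th (w 0%N) (ev g (w \o S))) (w n.+2).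
pose d := binop th (w 0%N) (binop th (w 1%N) (ev g ((w \o S) \o S))).
have -> : binop th (ev (n := n.+1) (gerst th g) w) (w n.+2) =
    a + e *: b - e *: C.
  rewrite ev_gerst_binop linearBl linearDl !linearZl_LR linear_sumlz.
  by congr (_ - _ *: _); apply: eq_bigr => i _; rewrite linearZl_LR.
have -> : binop th (w 0%N) (ev (n := n.+1) (gerst th g) (w \o S)) =
    b + e *: d - e *: F.
  rewrite ev_gerst_binop linearBr linearDr !linearZr_LR linear_sumr /= /b -thA.
  by congr (_ - _ *: _); apply: eq_bigr => i _; rewrite linearZr_LR.
have -> : \sum_(i < n.+2) (-1) ^+ i *:
      ev (n := n.+1) (gerst th g) (insert_seq th i w) =
    (C - e *: a) + e *: (d - F).
  under eq_bigr => i _ do rewrite ev_gerst_binop scalerBr scalerDr.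
  (* [Z] gathers the double contractions, which cancel among themselves. *)
  rewrite big_split big_split /=; set Z := \sum_(i < n.+2) - _.
  have -> : Z = 0.
    rewrite /Z sumrN; under eq_bigr => i _ do rewrite scalerA mulrC -scalerA.
    by rewrite -scaler_sumr sum_insert_binop scaler0 oppr0.
  rewrite addr0; congr (_ + _).
    (* Only the last contraction touches the two final arguments; associativity turns it into [a],
       and the others give [C]. *)
    rewrite big_ord_recr; congr (_ + _) => /=.
      apply: eq_bigr => i _; have lti := ltn_ord i; rewrite insert_binopE.
      by rewrite ltnNge (ltnW lti) /= gtn_eqF.
    rewrite insert_binopE ltnn eqxx exprS mulN1r scaleNr -/e /a -thA.
    congr (- (_ *: binop th _ _)); apply: ev_ext => k lek.
    by rewrite insert_binopE ltnS lek.
  (* Symmetrically, the contraction at 0 gives [d], and the others, shifted by one, give [F]. *)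
  under eq_bigr => i _ do rewrite scalerA mulrC -scalerA.
  rewrite -scaler_sumr big_ord_recl /= expr0 scale1r insert_binopE /= /d thA.
  congr (_ *: (binop th _ _ + _)).
    by apply: ev_ext => k _; rewrite [LHS]insert_binopE.
  rewrite /F -sumrN; apply: eq_bigr => i _.
  rewrite /bump add1n exprS mulN1r scaleNr insert_binopE /=.
  by congr (- (_ *: binop th _ _)).
rewrite !scaleNr opprK !(scalerDr, scalerN) !scalerA sg !scale1r.
rewrite -[e *: b + d - F]addrA -[LHS]addrA [- _ + _]addrC opprD.
rewrite [X in _ + X]addrACA subrr addr0 -(addrA (e *: C)) -opprD addrA.
by rewrite subrK subrr.
Qed.

End Hochschild.

(** * Reduction to arguments lying in A or in M *)

Section Pure.
Variables (K : fieldType) (A M : lmodType K).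
Local Notation V := (A * M)%type.

(** Induction on the number of arguments with both components nonzero: additivity splits one of them
    into its A part and its M part, and both resulting tuples have fewer mixed arguments. *)
Lemma multilinear_ext n (f g : {ffun 'I_n -> V} -> V) :
  multilinear f -> multilinear g ->
  (forall S v, pure S v -> f v = g v) -> f =1 g.
Proof.
move=> fP gP fg v.
pose mixed (w : {ffun 'I_n -> V}) := [set k | ((w k).1 != 0) && ((w k).2 != 0)].
have [m] := ubnP #|mixed v|; elim: m v => // m IHm v; rewrite ltnS => le.
have [v0|[k]] := set_0Vmem (mixed v).
  apply: (fg [set k | (v k).1 == 0]) => k; rewrite inE.
  case: eqP => // /eqP v1; have := in_set0 k; rewrite -v0 inE v1 /=.
  by move/negbFE/eqP.
rewrite inE => /andP[k1 k2].
have split_k h : multilinear h -> h v =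
    h (set_arg v k ((v k).1, 0)) + h (set_arg v k (0, (v k).2)).
  move=> hP; rewrite -[X in X + _]scale1r -hP scale1r -{1}(set_arg_id v k).
  by congr (h (set_arg _ _ _)); case: (v k) => a b; congr pair;
    rewrite ?addr0 ?add0r.
have less x : (x.1 == 0) || (x.2 == 0) -> (#|mixed (set_arg v k x)| < m)%N.
  move=> x0; have {}x0 : (x.1 != 0) && (x.2 != 0) = false.
    by rewrite -negb_or x0.
  apply: leq_trans le; apply/proper_card/properP; split; last first.
    by exists k; rewrite inE ?k1 // set_argE eqxx x0.
  by apply/subsetP => j; rewrite !inE set_argE; case: (j =P k) => // _;
    rewrite x0.
by rewrite !split_k // !IHm // less // eqxx ?orbT.
Qed.

(** Weight [n.+1] on [n.+1] arguments leaves only Hom(M^{n+1}, A), so cochains of T may be compared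
    there. *)
Lemma whom_top_ext n (f g : whom A M n.+1 n) :
  (forall v : {ffun 'I_n.+1 -> V}, (forall k, (v k).1 = 0) ->
    (f v).1 = (g v).1) -> f = g.
Proof.
move=> fg; apply: whom_ext; apply: multilinear_ext; try exact: homP.
move=> S v vS; have := whomP f vS; have := whomP g vS; rewrite /in_weight.
have [S1|S1] := eqVneq #|S| n.+1; last first.
  have : (#|S| <= n.+1)%N by rewrite -[X in (_ <= X)%N]card_ord max_card.
  by rewrite leq_eqVlt (negPf S1) /= => ltS; rewrite ltn_eqF 1?leqW // => -> ->.
have ST : S = setT by apply/eqP; rewrite eqEcard subsetT cardsT card_ord S1 /=.
move=> g2 f2.
have /fg : forall k, (v k).1 = 0 by move=> k; have := vS k; rewrite ST inE.
by move: f2 g2; case: (f v) => a m /= ->; case: (g v) => b n' /= -> ->.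
Qed.

Lemma multilinear_comp n (f : hom V n) (l : 'I_n.+1 -> V -> V) :
  (forall i, linear (l i)) -> multilinear (fun v => f [ffun k => l k (v k)]).
Proof.
move=> lP v i a x y.
have h z : [ffun k => l k (set_arg v i z k)] =
    set_arg [ffun k => l k (v k)] i (l i z).
  by apply/ffunP => k; rewrite !ffunE; case: eqP => [->|].
by rewrite !h lP homPE.
Qed.

Definition proj_A (x : V) : V := (x.1, 0).
Definition proj_M (x : V) : V := (0, x.2).

Fact proj_A_linear : linear proj_A.
Proof. by move=> a x y; congr pair; rewrite /= scaler0 addr0. Qed.
Fact proj_M_linear : linear proj_M.
Proof. by move=> a x y; congr pair; rewrite /= scaler0 addr0. Qed.

(* Of the [2 ^ n.+1] terms of the expansion of [f] only the [n.+2] ones with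
   at most one argument in [M] survive. *)
Lemma weight0E n (f : whom A M 0 n) v :
  f v = f [ffun j => proj_A (v j)]
    + \sum_(i < n.+1) f [ffun j => (if j == i then proj_M else proj_A) (v j)].
Proof.
move: v; apply: multilinear_ext => [||S v vS]; first exact: homP.
  move=> v i a x y /=; rewrite (multilinear_comp f (fun=> proj_A_linear)).
  have lP i0 : multilinear
      (fun v => f [ffun j => (if j == i0 then proj_M else proj_A) (v j)]).
    apply: (multilinear_comp f
      (l := fun j => if j == i0 then proj_M else proj_A)).
    by move=> j; case: eqP => _; [exact: proj_M_linear|exact: proj_A_linear].
  rewrite (eq_bigr _ (fun i0 _ => lP i0 v i a x y)) big_split /= -scaler_sumr.
  by rewrite addrACA scalerDr.
have pA k : k \notin S -> proj_A (v k) = v k /\ proj_M (v k) = 0.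
  have := vS k; rewrite /proj_A /proj_M; case: ifP => //= _.
  by case: (v k) => a m /= ->.
have pM k : k \in S -> proj_M (v k) = v k /\ proj_A (v k) = 0.
  have := vS k; rewrite /proj_A /proj_M; case: ifP => //= _.
  by case: (v k) => a m /= ->.
have [S0|[i iS]] := set_0Vmem S.
  have {}pA k : proj_A (v k) = v k /\ proj_M (v k) = 0.
    by apply: pA; rewrite S0 inE.
  rewrite big1 => [|i _]; last first.
    by rewrite (@hom0 _ _ _ f _ i) // ffunE eqxx (pA i).2.
  by rewrite addr0; congr (f _); apply/ffunP => j; rewrite ffunE (pA j).1.
rewrite [X in _ = X + _](@hom0 _ _ _ f _ i) ?ffunE ?(pM i iS).2 // add0r.
rewrite (bigD1 i) //=.
rewrite big1 => [|k /negPf ki]; last first.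
  by rewrite (@hom0 _ _ _ f _ i) // ffunE eq_sym ki (pM i iS).2.
rewrite addr0; have [Si|[j]] := set_0Vmem (S :\ i).
  congr (f _); apply/ffunP => k; rewrite ffunE.
  have [->|ki] := eqVneq k i; first by rewrite (pM i iS).1.
  by rewrite (pA k _).1 //; have := in_set0 k; rewrite -Si !inE ki /= => ->.
(* With two arguments in M, both sides vanish: the right one because slot [j] is projected to A, the
   left one by weight. *)
rewrite !inE => /andP[/negPf ji jS].
rewrite [RHS](@hom0 _ _ _ f _ j) ?ffunE ?ji ?(pM j jS).2 //.
have := whomP f vS; rewrite /in_weight (cardsD1 i) iS (cardsD1 j) !inE ji jS.
by [].
Qed.

End Pure.

(** * The products [pi] and [[pi, T]] *)

Section RelativeRotaBaxter.
Variables (K : fieldType) (A M : lmodType K) (R : relRB A M).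
Local Notation V := (A * M)%type.
Local Notation T := (rb_op R).
Local Notation mul := (rb_mul R).
Local Notation lact := (rb_left R).
Local Notation ract := (rb_right R).

Definition pi_T : hom V 1 := gerst (pi_hom R) (T_hom R).

Lemma pi_TE x y : binop pi_T x y =
  (mul (T x.2) y.1 + mul x.1 (T y.2) - T (lact x.1 y.2 + ract x.2 y.1),
   lact (T x.2) y.2 + ract x.2 (T y.2)).
Proof.
rewrite -[LHS]/(ev (n := 1) (circ (pi_hom R) (T_hom R)) _
  - (-1) ^+ (1 * 0) *: ev (n := 1) (circ (T_hom R) (pi_hom R)) _).
rewrite !ev_circ // big_ord_recl !big_ord1 muln0 !expr0 !scale1r.
rewrite /= /ev /pi_fun /Text /insert_seq /ev !ffunE /=.
by congr pair; rewrite ?linear0l ?linear0r ?addr0 ?add0r ?subr0.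
Qed.

Lemma binop_pi_homE x y :
  binop (pi_hom R) x y = (mul x.1 y.1, lact x.1 y.2 + ract x.2 y.1).
Proof. by rewrite /binop /ev /= /pi_fun !ffunE. Qed.

Lemma binop_pi_homA : associative (binop (pi_hom R)).
Proof.
move=> x y z; rewrite !binop_pi_homE /=; congr pair; first exact: rb_mulA.
by rewrite linearDr linearDl rb_leftA rb_rightA rb_midA addrA.
Qed.

(** The product is a semidirect one: M is an algebra under T(m) n + m T(n), which T maps
    multiplicatively to A, and A is a bimodule over it with actions T(m) a - T(m a) and a T(m) - T(a
    m). *)
Lemma binop_pi_TA : associative (binop pi_T).
Proof.
move=> [a m] [b n] [c p]; rewrite !pi_TE /=; congr pair; last first.
  by rewrite -!rb_opM rb_leftA rb_rightA linearDr linearDl /= rb_midA addrA.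
(* Expanding T(w) T(p) and T(m) T(w') by the Rota-Baxter identity yields the terms T(T(w) p) and T(m
   T(w')), which cancel those coming from the outer action. *)
rewrite -(rb_opM R m n) -(rb_opM R n p); set w := lact a n + _.
set w' := lact b p + _.
rewrite !(linearBr, linearDr, linearBl, linearDl) /= !rb_opM -!rb_mulA.
rewrite !rb_leftA !rb_rightA /w /w' !linearDr !linearDl !rb_midA.
have cancelZ (U : zmodType) (L Z P Q : U) : L + Z + (P + (Q - Z)) = L + P + Q.
  by rewrite addrACA [Z + _]addrC subrK.
have subT2 x u v : x - T u - T v = x - T (u + v).
  by rewrite linearD opprD addrA.
rewrite [X in X - _ = _]addrAC [X in _ = X - _]addrA !subT2 cancelZ.
rewrite [X in _ = _ - T X]addrA [X in _ = _ - T (X + _ + _)]addrC.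
rewrite [X in _ = _ - T (X + _)]addrACA subrr addr0 -!rb_opM -rb_mulA !addrA.
by rewrite [X in _ - T X = _](ACl (4 * 6 * 1 * 3 * 2 * 5)) /=.
Qed.

(** * Conjugation by [1 + T], and [Omega] as a morphism up to sign *)

Definition shear (x : V) : V := x + Text R x.
Definition unshear (x : V) : V := x - Text R x.

Fact unshear_linear : linear unshear.
Proof. by move=> a x y; rewrite /unshear linearP scalerBr opprD addrACA. Qed.
HB.instance Definition _ := GRing.isLinear.Build K V V *:%R unshear
  unshear_linear.

Lemma unshearK : cancel unshear shear.
Proof.
move=> x; rewrite /shear /unshear linearB /= [Text R (Text R x)]/Text /=.
by rewrite linear0 subr0 subrK.
Qed.

Definition shear_conj n (f : {ffun 'I_n.+1 -> V} -> V)
    (v : {ffun 'I_n.+1 -> V}) : V :=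
  unshear (f [ffun k => shear (v k)]).

Lemma ev_shear_conj n (f : {ffun 'I_n.+1 -> V} -> V) w :
  ev (shear_conj f) w = unshear (ev f (shear \o w)).
Proof. by congr (unshear (f _)); apply/ffunP => k; rewrite !ffunE. Qed.

(** At the inserted slot, the [shear] applied to the argument of [f] undoes the [unshear] applied to
    the value of [g]. *)
Lemma ev_circ_shear_conj m n p (f : {ffun 'I_m.+1 -> V} -> V)
    (g : {ffun 'I_n.+1 -> V} -> V) w : p = (m + n)%N ->
  ev (@circ _ _ m n p (shear_conj f) (shear_conj g)) w =
  ev (shear_conj (@circ _ _ m n p f g)) w.
Proof.
move=> e; rewrite ev_shear_conj !ev_circ // linear_sum; apply: eq_bigr => i _.
rewrite linearZ ev_shear_conj; congr (_ *: unshear _); apply: ev_ext => k _.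
rewrite /= /insert_seq; case: ifP => // _; case: ifP => // _.
by rewrite ev_shear_conj unshearK.
Qed.

(** Beyond first order in T, the expansion leaves T(m) T(n) - T(T(m) n + m T(n)), which is zero by
    [rb_opM]. *)
Lemma shear_conj_piE w : ev (n := 1) (shear_conj (pi_hom R)) w =
  ev (n := 1) (pi_hom R) w + ev (n := 1) pi_T w.
Proof.
rewrite ev_shear_conj !ev_binop !binop_pi_homE pi_TE /=.
case: (w 0%N) (w 1%N) => [a m] [b n].
rewrite /unshear /shear /Text /=; congr pair; last first.
  rewrite /= !addr0 subr0 linearDl linearDr /= addrACA.
  by [].
rewrite /= !addr0 !linearDl !linearDr /= [X in _ - T X]addrACA linearD.
rewrite -rb_opM !addrA opprD addrACA subrr addr0; congr (_ - _).
by rewrite addrAC.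
Qed.

(** By [weight0E], [f] at the arguments u + T u is f(T u, ..., T u), in A, plus the terms with a
    single unsheared argument, in M. Applying [unshear] subtracts T of the latter from the A
    component. *)
Lemma Omega_shear_conj n (f : whom A M 0 n) (v : {ffun 'I_n.+1 -> V}) :
  (forall k, (v k).1 = 0) ->
  (Omega_fun R f v).1 = (-1) ^+ n.+1 *: (shear_conj f v).1.
Proof.
move=> v0; congr (_ *: _); rewrite [in RHS]/shear_conj /unshear.
have -> : f [ffun k => shear (v k)] = f [ffun j => Text R (v j)] +
    \sum_(i < n.+1) f [ffun j => if j == i then v j else Text R (v j)].
  rewrite weight0E; congr (f _ + _).
    apply/ffunP => j; rewrite !ffunE.
    by rewrite /proj_A /shear /Text /= v0 add0r.
  apply: eq_bigr => i _; congr (f _); apply/ffunP => j; rewrite !ffunE.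
  case: eqP => _; rewrite /proj_A /proj_M /shear /Text /= ?v0 ?add0r // addr0.
  by move: (v0 j); case: (v j) => a m /= ->.
have f0 (u : {ffun 'I_n.+1 -> V}) : (forall j, (u j).2 = 0) -> (f u).2 = 0.
  move=> u0; have : pure set0 u by move=> j; rewrite inE.
  by move=> /(whomP f); rewrite /in_weight cards0.
have TT : Text R (f [ffun j => Text R (v j)]) = 0.
  by rewrite /Text f0 ?linear0 // => j; rewrite ffunE.
set F := fun i => f [ffun j => if j == i then v j else Text R (v j)].
have -> : Text R (f [ffun j => Text R (v j)] + \sum_i F i) =
    \sum_i Text R (F i).
  by rewrite raddfD raddf_sum [X in X + _]TT add0r.
rewrite addrAC -[LHS]addr0; congr (_ + _).
rewrite (raddf_sum fst) big1 // => i _.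
have vi : pure [set i] [ffun j => if j == i then v j else Text R (v j)].
  by move=> j; rewrite inE ffunE; case: eqP.
by have := whomP f vi; rewrite /in_weight cards1.
Qed.

Lemma ev_Omega n (f : whom A M 0 n) w : (forall k, (w k).1 = 0) ->
  (ev (Omega_fun R f) w).1 = (-1) ^+ n.+1 *: (ev (shear_conj f) w).1.
Proof. by move=> w0; apply: Omega_shear_conj => k; rewrite ffunE. Qed.

(* One of the two arguments being in [M], [pi] does not contribute to the
   component in [A], and that of [pi_T] only depends on the component in [A]
   of the other argument. *)
Lemma fst_shear_conj_pi_l c x x' y : x.1 = c *: x'.1 -> y.1 = 0 ->
  (binop (pi_hom R) x y + binop pi_T x y).1 = c *: (binop pi_T x' y).1.
Proof.
move=> xx' y0; rewrite binop_pi_homE !pi_TE /= y0 xx' !linear0r !addr0 !add0r.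
by rewrite !linearZl_LR linearZ /= scalerBr.
Qed.

Lemma fst_shear_conj_pi_r c x y y' : y.1 = c *: y'.1 -> x.1 = 0 ->
  (binop (pi_hom R) x y + binop pi_T x y).1 = c *: (binop pi_T x y').1.
Proof.
move=> yy' x0; rewrite binop_pi_homE !pi_TE /= x0 yy' !linear0l !addr0 !add0r.
by rewrite !linearZr_LR linearZ /= scalerBr.
Qed.

Lemma Omega_d_AM n (f : whom A M 0 n) :
  Omega_whom R (d_AM R f) = (-1) ^+ n.+1 *: d_T R (Omega_whom R f).
Proof.
apply: whom_top_ext => u u0.
set w := fun k : nat => u (inord k).
have w0 k : (w k).1 = 0 by exact: u0.
pose G := gerst (pi_hom R) f; pose C := shear_conj.
(* The sign (-1)^(n+2) of [Omega] and the sign (-1)^n of [d_AM] cancel. *)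
have -> : (Omega_whom R (d_AM R f) u).1 = (ev (n := n.+1) (C _ G) w).1.
  rewrite ev_inord ev_Omega // !ev_shear_conj.
  rewrite -[ev (d_AM R f) _]/((-1) ^+ n *: ev (n := n.+1) G (shear \o w)).
  by rewrite linearZ /= scalerA !exprS !mulN1r opprK -expr2 sqrr_sign scale1r.
have -> : (((-1) ^+ n.+1 *: d_T R (Omega_whom R f)) u).1 =
    (-1) ^+ n.+1 *: (ev (n := n.+1) (gerst pi_T (Omega_whom R f)) w).1.
  rewrite -[X in ev X]/(d_T R (Omega_whom R f) : {ffun _ -> _} -> _).
  by rewrite -(ev_inord (d_T R (Omega_whom R f)) u).
have -> : ev (n := n.+1) (C _ G) w =
    ev (n := n.+1) (circ (C 1%N (pi_hom R)) (C _ f)) w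
    - (-1) ^+ (1 * n) *: ev (n := n.+1) (circ (C _ f) (C 1%N (pi_hom R))) w.
  rewrite !ev_circ_shear_conj ?addn1 // !ev_shear_conj -linearZ -linearB.
  by [].
rewrite -[ev (n := n.+1) (gerst pi_T (Omega_whom R f)) w]/(
  ev (n := n.+1) (circ pi_T (Omega_fun R f)) w
  - (-1) ^+ (1 * n) *: ev (n := n.+1) (circ (Omega_fun R f) pi_T) w).
rewrite !ev_circ ?addn1 //.
(* The product [pi] vanishes on two arguments in M, so only the summand [pi_T] of its conjugate is
   inserted. *)
have -> : \sum_(i < n.+1) (-1) ^+ (i * 1) *:
      ev (C _ f) (insert_seq (C 1%N (pi_hom R)) i w) =
    \sum_(i < n.+1) (-1) ^+ (i * 1) *:
      ev (C _ f) (insert_seq pi_T i w).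
  apply: eq_bigr => i _; congr (_ *: _); apply: ev_ext => k _.
  rewrite /insert_seq; case: ifP => // _; case: ifP => // _.
  rewrite shear_conj_piE ev_binop binop_pi_homE !w0 linear0l linear0l linear0r.
  rewrite addr0; exact: add0r.
have fstB c (x y x' y' : V) s : x.1 = s *: x'.1 -> y.1 = s *: y'.1 ->
    (x - c *: y).1 = s *: (x' - c *: y').1.
  by move=> /= -> ->; rewrite scalerBr !scalerA mulrC.
have fst_sum N s (c : nat -> K) (F F' : nat -> V) :
    (forall i, (i < N)%N -> (F i).1 = s *: (F' i).1) ->
    (\sum_(i < N) c i *: F i).1 = s *: (\sum_(i < N) c i *: F' i).1.
  move=> FF'; rewrite !(raddf_sum fst) scaler_sumr; apply: eq_bigr => i _ /=.
  by rewrite FF' // !scalerA mulrC.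
have CO w' : (forall k, (w' k).1 = 0) ->
    (ev (C _ f) w').1 = (-1) ^+ n.+1 *: (ev (Omega_fun R f) w').1.
  by move=> w'0; rewrite ev_Omega // scalerA -expr2 sqrr_sign scale1r.
apply: fstB; last first.
  (* M is closed under [pi_T], so [Omega f] is again evaluated on arguments in M and [CO]
     applies. *)
  pose W i := insert_seq pi_T i w.
  apply: (@fst_sum n.+1 _ (fun i => (-1) ^+ (i * 1))
    (fun i => ev (C n f) (W i)) (fun i => ev (Omega_fun R f) (W i))) => i _.
  apply: CO => k; rewrite /W /insert_seq; case: ifP => // _; case: ifP => // _.
  rewrite ev_binop pi_TE /= !w0 !linear0l !linear0r /= !addr0.
  by rewrite linear0 subr0.
(* [X] and [Y] differ only in the inserted value, whose A components agree up to sign; the other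
   argument of the product lies in M. *)
pose X i := insert_seq (C n f) i w; pose Y i := insert_seq (Omega_fun R f) i w.
apply: (@fst_sum 2 _ (fun i => (-1) ^+ (i * n))
  (fun i => ev (C 1%N (pi_hom R)) (X i)) (fun i => ev pi_T (Y i))).
have XY i : (X i i).1 = (-1) ^+ n.+1 *: (Y i i).1.
  by rewrite /X /Y /insert_seq ltnn eqxx CO.
move=> [|[|//]] _; rewrite shear_conj_piE !ev_binop.
  have -> : X 0%N 1%N = Y 0%N 1%N by [].
  by apply: fst_shear_conj_pi_l; [exact: XY|exact: w0].
have -> : X 1%N 0%N = Y 1%N 0%N by [].
by apply: fst_shear_conj_pi_r; [exact: XY|exact: w0].
Qed.

End RelativeRotaBaxter.

(** * Linear maps induced on quotients and on cohomology *)

Section Descent.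
Variables (K : fieldType) (V W : lmodType K) (S : submodClosed V).
Variables (F : {linear V -> W}) (F0 : forall v, v \in S -> F v = 0).

(* [F0] is a parameter so that the [Linear] instance can be inferred. *)
#[using="F0"]
Definition descend (q : quot_space S) : W :=
  F (repr (q : Quotient.quot (quot_pred S))).

Lemma descendE v : descend (quot_proj S v) = F v.
Proof.
apply/eqP; rewrite -subr_eq0 -linearB F0 // -quot_projP.
by rewrite quot_proj_repr.
Qed.

Fact descend_linear : linear descend.
Proof.
move=> a p q; rewrite -[p]quot_proj_repr -[q]quot_proj_repr.
by rewrite -linearP !descendE linearP.
Qed.
HB.instance Definition _ :=
  GRing.isLinear.Build K (quot_space S) W *:%R descend descend_linear.
End Descent.

Section Cohomology.
Variables (K : fieldType).
Implicit Types C D : cochains K.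

Lemma cls_surj C n q : exists z, cls C n z = q.
Proof. by exists (repr (q : Quotient.quot _)); exact: quot_proj_repr. Qed.

Lemma cls_eq C n (z t : cocycle C n) :
  cls C n z = cls C n t <-> coboundaryP (cocycle_val z - cocycle_val t).
Proof.
split=> [/eqP|zt]; first by rewrite quot_projP => /asboolP.
by apply/eqP; rewrite quot_projP; apply/asboolP.
Qed.

Lemma cls_eq0 C n (z : cocycle C n) :
  cls C n z = 0 <-> coboundaryP (cocycle_val z).
Proof. by rewrite -(linear0 (cls C n)) cls_eq subr0. Qed.

Lemma cocycleP C n (z : cocycle C n) : diff C n (cocycle_val z) = 0.
Proof. by case: z => z /= /eqP. Qed.

Lemma cocycle_of C n (x : C n) : diff C n x = 0 ->
  exists z : cocycle C n, cocycle_val z = x.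
Proof. by move=> /eqP xP; exists (Cocycle xP). Qed.

Section Induced.
Variables (C D : cochains K) (n m : nat) (g : {linear C n -> D m}).
Hypothesis gZ : forall x, diff C n x = 0 -> diff D m (g x) = 0.
Hypothesis gB : forall x, coboundaryP x -> coboundaryP (g x).

Fact map_cocycle_subproof (z : cocycle C n) :
  g (cocycle_val z) \in @is_cocycle K D m.
Proof. by apply/eqP/gZ/cocycleP. Qed.
Definition map_cocycle z : cocycle D m := Cocycle (map_cocycle_subproof z).

Definition map_cls z := cls D m (map_cocycle z).

Fact map_cls_linear : linear map_cls.
Proof.
move=> a x y; rewrite /map_cls -linearP; congr (cls D m _); apply: val_inj.
exact: (linearP g).
Qed.
HB.instance Definition _ := GRing.isLinear.Build K (cocycle C n)
  (cohomology D m) *:%R map_cls map_cls_linear.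

Fact map_cls_coboundary z : z \in @is_coboundary K C n ->
  map_cls z = 0.
Proof. by move=> /asboolP /gB zB; apply/cls_eq0. Qed.

(** Asking only that cocycles and coboundaries be preserved accommodates [inclT] and [Omega], which
    commute with the differentials up to sign. *)
Definition induced : {linear cohomology C n -> cohomology D m} :=
  descend map_cls_coboundary.

Lemma inducedP : induced_by g induced.
Proof.
move=> z; exists (map_cocycle z) => //; exact: (descendE map_cls_coboundary).
Qed.
End Induced.

End Cohomology.


Local Arguments diff : simpl never.

(** * The mapping cone of [Omega] and its long exact sequence *)

Section LongExactSequence.
Variables (K : fieldType) (A M : lmodType K) (R : relRB A M).

Lemma CT_complex : is_complex (CT R).
Proof.
move=> [|[|n]] P; [by []|exact: linear0|].
by apply: whom_ext => v; exact: (gerst_gerst_binop (@binop_pi_TA _ _ _ R)).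
Qed.

Lemma CAM_complex : is_complex (CAM R).
Proof.
move=> [|n] f; first exact: linear0.
pose g : whom A M 0 n.+1 := wgerst (pi_whom R) f.
rewrite -[LHS]/(d_AM R ((-1) ^+ n *: g)) linearZ /= /d_AM.
have -> : (wgerst (pi_whom R) g : whom A M 0 n.+2) = 0.
  apply: whom_ext => v; exact: (gerst_gerst_binop (@binop_pi_homA _ _ _ R)).
by rewrite !scaler0.
Qed.

Lemma Omega_diff n f : Omega R n.+1 (diff (CAM R) n f) =
  (-1) ^+ n *: diff (CT R) n.+1 (Omega R n f).
Proof.
case: n f => [|n] f; last exact: Omega_d_AM.
rewrite (_ : diff (CAM R) 0 f = 0) // (_ : diff (CT R) 1 _ = 0) //.
by rewrite linear0 scaler0.
Qed.

Lemma CAMT_diffE n (x : CAMT R n) : diff (CAMT R) n x =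
  (diff (CAM R) n x.1, (-1) ^+ n *: diff (CT R) n x.2 + Omega R n x.1).
Proof. by []. Qed.

(** In the second component, the cross terms (-1)^(n+1) d_T (Omega f) and Omega (d f) = (-1)^n d_T
    (Omega f) cancel. *)
Lemma CAMT_complex : is_complex (CAMT R).
Proof.
move=> n [f P]; rewrite !CAMT_diffE /= CAM_complex Omega_diff.
rewrite linearP CT_complex scaler0 add0r exprS mulN1r scaleNr addNr.
by [].
Qed.

Fact inclT_linear n : linear (@inclT K A M R n).
Proof. by move=> a P Q; congr pair; rewrite /= scaler0 addr0. Qed.
HB.instance Definition _ n := GRing.isLinear.Build K (CT R n) (CAMT R n) *:%R
  (@inclT K A M R n) (@inclT_linear n).

Fact projAM_linear n : linear (@projAM K A M R n).
Proof. by []. Qed.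
HB.instance Definition _ n := GRing.isLinear.Build K (CAMT R n) (CAM R n) *:%R
  (@projAM K A M R n) (@projAM_linear n).

Lemma inclT_cocycle n P : diff (CT R) n P = 0 -> diff (CAMT R) n (inclT P) = 0.
Proof.
by move=> dP; rewrite CAMT_diffE /= dP scaler0 add0r !linear0.
Qed.

Lemma inclT_coboundary n (P : CT R n) : coboundaryP P -> coboundaryP (inclT P).
Proof.
case: n P => [|n] P; first by move=> ->; exact: linear0.
(* The sign compensates the one in front of [d_T] in the cone differential. *)
move=> [Q <-]; exists (0, (-1) ^+ n *: Q); rewrite CAMT_diffE /= !linear0 addr0.
by rewrite linearZ scalerA -expr2 sqrr_sign scale1r.
Qed.

Lemma projAM_cocycle n x : diff (CAMT R) n x = 0 ->
  diff (CAM R) n (projAM x) = 0.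
Proof. by rewrite CAMT_diffE => -[]. Qed.

Lemma projAM_coboundary n (x : CAMT R n) :
  coboundaryP x -> coboundaryP (projAM x).
Proof.
case: n x => [|n] x; first by move=> ->.
by move=> [y <-]; exists y.1.
Qed.

Lemma Omega_cocycle n f : diff (CAM R) n f = 0 ->
  diff (CT R) n.+1 (Omega R n f) = 0.
Proof.
move=> df; have := Omega_diff f; rewrite df linear0 => /esym/eqP.
by rewrite scaler_eq0 signr_eq0 => /eqP.
Qed.

Lemma Omega_coboundary n (f : CAM R n) :
  coboundaryP f -> @coboundaryP K (CT R) n.+1 (Omega R n f).
Proof.
case: n f => [|n] f; first by move=> ->; exists 0; rewrite !linear0.
move=> [g <-]; exists ((-1) ^+ n *: Omega R n g).
by rewrite Omega_diff linearZ.
Qed.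

Definition H_incl n := induced (g := @inclT K A M R n)
  (@inclT_cocycle n) (@inclT_coboundary n).
Definition H_proj n := induced (g := @projAM K A M R n)
  (@projAM_cocycle n) (@projAM_coboundary n).
Definition connecting n := @induced K (CAM R) (CT R) n n.+1 (Omega R n)
  (@Omega_cocycle n) (@Omega_coboundary n).

(** Any cocycle with the right underlying cochain may serve as representative of the image. *)
Lemma H_inclE n (z : cocycle (CT R) n) (t : cocycle (CAMT R) n) :
  cocycle_val t = (0, cocycle_val z) -> H_incl n (cls _ n z) = cls _ n t.
Proof.
move=> tz.
have [w wz ->] := inducedP (@inclT_cocycle n) (@inclT_coboundary n) z.
by congr (cls _ n _); apply: val_inj; rewrite /= wz tz.
Qed.

Lemma H_projE n (z : cocycle (CAMT R) n) (t : cocycle (CAM R) n) :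
  cocycle_val t = (cocycle_val z).1 -> H_proj n (cls _ n z) = cls _ n t.
Proof.
move=> tz.
have [w wz ->] := inducedP (@projAM_cocycle n) (@projAM_coboundary n) z.
by congr (cls _ n _); apply: val_inj; rewrite /= wz tz.
Qed.

Lemma connectingE n (z : cocycle (CAM R) n) (t : cocycle (CT R) n.+1) :
  cocycle_val t = Omega R n (cocycle_val z) ->
  connecting n (cls _ n z) = cls _ n.+1 t.
Proof.
move=> tz.
have [w wz ->] := inducedP (@Omega_cocycle n) (@Omega_coboundary n) z.
by congr (cls _ n.+1 _); apply: val_inj; rewrite /= wz tz.
Qed.

(** The sequence starts at the zero space C^0(T), all of whose elements are equal. *)
Lemma H_incl0_inj : injective (H_incl 0).
Proof.
move=> p q _; have [z <-] := cls_surj p; have [t <-] := cls_surj q.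
by congr (cls _ _ _); apply: val_inj; rewrite /= [LHS]thinmx0 [RHS]thinmx0.
Qed.

(** If f = d g, subtracting the cone coboundary of (g, 0) from (f, P) leaves (0, P - Omega g). *)
Lemma exact_incl_proj n : exact_at (H_incl n) (H_proj n).
Proof.
move=> y; split=> [|[q <-]]; last first.
  have [t <-] := cls_surj q.
  have [s st] := cocycle_of (inclT_cocycle (cocycleP t)).
  by rewrite (H_inclE st) (@H_projE _ _ 0) ?linear0 // st.
have [z <-] := cls_surj y.
have [x zx] := cocycle_of (projAM_cocycle (cocycleP z)).
rewrite (H_projE zx) cls_eq0 zx.
case: n y z x zx => [|n] y z x zx.
  (* In degree 0 only zero is a coboundary, so the first component itself vanishes. *)
  move=> /= z1.
  have [t tz] : exists t : cocycle (CT R) 0, cocycle_val t = (cocycle_val z).2.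
    exact: cocycle_of.
  exists (cls _ _ t); apply: H_inclE; rewrite tz -z1.
  by case: (cocycle_val z).
move=> [g]; rewrite -[projAM _]/((cocycle_val z).1) => gz.
have : diff (CT R) n.+1 ((cocycle_val z).2 - Omega R n g) = 0.
  have := congr1 snd (cocycleP z); rewrite CAMT_diffE /= -gz Omega_diff.
  rewrite exprS mulN1r scaleNr addrC -scalerBr => /eqP.
  rewrite scaler_eq0 signr_eq0 /= -linearB -oppr_eq0 -linearN opprB => /eqP.
  by [].
move=> /cocycle_of[t tz]; exists (cls _ _ t).
have [s st] := cocycle_of (inclT_cocycle (cocycleP t)).
rewrite (H_inclE st) cls_eq st tz; exists (- g, 0).
rewrite CAMT_diffE /= !linearN linear0 scaler0 add0r /= gz.
rewrite /inclT /projAM; case: (cocycle_val z) => f P /=.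
by congr pair; rewrite /= ?sub0r // addrAC subrr add0r.
Qed.

(** A primitive [Q] of Omega f is, up to the factor - (-1)^n, the same thing as a second component
    completing the cocycle f to a cocycle of the cone. *)
Lemma exact_proj_connecting n : exact_at (H_proj n) (connecting n).
Proof.
move=> y; split=> [|[q <-]]; last first.
  have [z <-] := cls_surj q.
  have [x zx] := cocycle_of (projAM_cocycle (cocycleP z)).
  have [t tx] := cocycle_of (Omega_cocycle (cocycleP x)).
  rewrite (H_projE zx) (connectingE tx) cls_eq0 tx zx.
  exists (- ((-1) ^+ n *: (cocycle_val z).2)); rewrite linearN linearZ /=.
  apply/eqP; rewrite eq_sym -addr_eq0 addrC.
  by have := congr1 snd (cocycleP z); rewrite CAMT_diffE /= => ->.
have [x <-] := cls_surj y.
have [t tx] := cocycle_of (Omega_cocycle (cocycleP x)).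
rewrite (connectingE tx) cls_eq0 tx => -[Q dQ].
have : diff (CAMT R) n (cocycle_val x, - ((-1) ^+ n *: Q)) = 0.
  rewrite CAMT_diffE /= cocycleP linearN linearZ /= scalerN scalerA -expr2.
  by rewrite sqrr_sign scale1r dQ addNr.
by move=> /cocycle_of[z zx]; exists (cls _ _ z); apply: H_projE; rewrite zx.
Qed.

(** That (0, P) is the cone coboundary of (g, Q) means d g = 0 and P = (-1)^n d_T Q + Omega g, so P
    and Omega g are cohomologous. *)
Lemma exact_connecting_incl n : exact_at (connecting n) (H_incl n.+1).
Proof.
move=> y; split=> [|[q <-]]; last first.
  have [x <-] := cls_surj q.
  have [t tx] := cocycle_of (Omega_cocycle (cocycleP x)).
  have [s st] := cocycle_of (inclT_cocycle (cocycleP t)).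
  rewrite (connectingE tx) (H_inclE st) cls_eq0 st tx.
  exists (cocycle_val x, 0).
  by rewrite CAMT_diffE /= cocycleP linear0 scaler0 add0r.
have [t <-] := cls_surj y.
have [s st] := cocycle_of (inclT_cocycle (cocycleP t)).
rewrite (H_inclE st) cls_eq0 st => -[[g Q] gQ].
have dg : diff (CAM R) n g = 0 := congr1 fst gQ.
have dQ : (-1) ^+ n *: diff (CT R) n Q + Omega R n g = cocycle_val t.
  exact: (congr1 snd gQ).
have [x xg] := cocycle_of dg; exists (cls _ _ x).
have [r rx] := cocycle_of (Omega_cocycle (cocycleP x)).
rewrite (connectingE rx) cls_eq rx xg -dQ; exists (- ((-1) ^+ n *: Q)).
by rewrite linearN linearZ /= opprD addrCA subrr addr0.
Qed.

End LongExactSequence.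

Theorem theorem4p6 (K : fieldType) (charK : [pchar K] =i pred0)
    (A M : lmodType K) (R : relRB A M) :
  [/\ is_complex (CT R), is_complex (CAM R) & is_complex (CAMT R)] /\
  exists (Hi : forall n : nat,
            {linear cohomology (CT R) n -> cohomology (CAMT R) n})
         (Hp : forall n : nat,
            {linear cohomology (CAMT R) n -> cohomology (CAM R) n})
         (delta : forall n : nat,
            {linear cohomology (CAM R) n -> cohomology (CT R) n.+1}),
    [/\ forall n : nat, induced_by (@inclT K A M R n) (Hi n),
        forall n : nat, induced_by (@projAM K A M R n) (Hp n)
      & forall n : nat, @induced_by K (CAM R) (CT R) n n.+1 (Omega R n) (delta n)] /\
    [/\ injective (Hi 0%N),
        forall n : nat, exact_at (Hi n) (Hp n),
        forall n : nat, exact_at (Hp n) (delta n)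
      & forall n : nat, exact_at (delta n) (Hi n.+1)].
Proof.
split.
  by split; [exact: CT_complex|exact: CAM_complex|exact: CAMT_complex].
exists (H_incl R), (H_proj R), (connecting R); split.
  by split=> n; exact: inducedP.
split; [exact: H_incl0_inj|exact: exact_incl_proj|
  exact: exact_proj_connecting|exact: exact_connecting_incl].
Qed.
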